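(* Let $t,r$ be integers with $t\geq 6$ and $r\in\{1,2\}$. Write $t-2=2p+q$ with $p$ an integer and $q\in\{0,1\}$. Then $$\operatorname{gr}_4(P_5:S_t^r)=t+p-1 .$$
   Context: All graphs are finite, simple and undirected. $K_n$ is the complete graph on $n$ vertices and $P_5$ is the path with $5$ vertices and $4$ edges. $S_t^r$ is the graph of order $t$ obtained from the star $K_{1,t-1}$ by adding $r$ pairwise independent edges between the leaves, so that it has $r$ triangles (sharing the center) and $t-2r-1$ pendent edges. A $k$-edge-coloring assigns to each edge one of $k$ colors; all $k$-edge-colorings are assumed exact, i.e. each of the $k$ colors is used at least once. An edge-colored graph is rainbow if all its edges have different colors and monochromatic if all its edges have a single color. A copy of a graph means a (not necessarily induced) subgraph isomorphic to it. For non-empty graphs $G,H$ (graphs with at least one edge) and a positive integer $k$, the Gallai-Ramsey number $\operatorname{gr}_k(G:H)$ is the minimum integer $N$ with $\binom{N}{2}\geq k$ (so that $K_N$ admits a $k$-edge-coloring) such that for all $n\geq N$, every $k$-edge-coloring of $K_n$ contains either a rainbow copy of $G$ or a monochromatic copy of $H$. *)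

(* Defs.v *)
From mathcomp Require Import all_boot.

Set Implicit Arguments.
Unset Strict Implicit.
Unset Printing Implicit Defensive.

Record sgraph := SGraph {
  vertex :> finType;
  adj : rel vertex;
  adj_sym : symmetric adj;
  adj_irr : irreflexive adj
}.

Definition edges (G : sgraph) : {set {set G}} :=
  [set [set p.1; p.2] | p : G * G & adj p.1 p.2].

Section Complete.
Variable n : nat.
Definition complete_adj : rel 'I_n := fun x y => x != y.
Lemma complete_adj_sym : symmetric complete_adj.
Proof. by move=> x y; rewrite /complete_adj eq_sym. Qed.
Lemma complete_adj_irr : irreflexive complete_adj.
Proof. by move=> x; rewrite /complete_adj eqxx. Qed.
Definition complete_graph : sgraph :=
  SGraph complete_adj_sym complete_adj_irr.
End Complete.

Section Path.
Variable n : nat.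
Definition path_adj : rel 'I_n := fun x y => (x.+1 == y) || (y.+1 == x).
Lemma path_adj_sym : symmetric path_adj.
Proof. by move=> x y; rewrite /path_adj orbC. Qed.
Lemma path_adj_irr : irreflexive path_adj.
Proof. by move=> x; rewrite /path_adj orbb gtn_eqF. Qed.
Definition path_graph : sgraph := SGraph path_adj_sym path_adj_irr.
End Path.

(* S_t^r, intended for 2r <= t - 1: vertex 0 is the center, the leaves are    *)
(* 1, ..., t - 1, and the r added independent edges are                       *)
(* {1, 2}, {3, 4}, ..., {2r - 1, 2r}.                                         *)
Section Star.
Variables t r : nat.
Definition star_arc : rel 'I_t := fun x y =>
  ((x == 0 :> nat) && (y != 0 :> nat))
  || [&& odd x, y == x.+1 :> nat & y <= 2 * r].
Definition star_adj : rel 'I_t := fun x y => star_arc x y || star_arc y x.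
Lemma star_adj_sym : symmetric star_adj.
Proof. by move=> x y; rewrite /star_adj orbC. Qed.
Lemma star_adj_irr : irreflexive star_adj.
Proof. by move=> x; rewrite /star_adj /star_arc orbb andbN ltn_eqF // andbF. Qed.
Definition star_graph : sgraph := SGraph star_adj_sym star_adj_irr.
End Star.

(* An edge coloring of G is given by a function on all vertex sets; only its  *)
(* values on edges G are ever used.                                           *)
Definition coloring (k : nat) (G : sgraph) := {set G} -> 'I_k.

Definition exact (k : nat) (G : sgraph) (c : coloring k G) : Prop :=
  forall i : 'I_k, exists2 e, e \in edges G & c e = i.

(* A copy of G in K is presented by an isomorphism f from G onto it, that is, *)
(* by an injective homomorphism from G to K.                                  *)
Definition embedding (G K : sgraph) (f : G -> K) : Prop :=
  injective f /\ {homo f : x y / adj x y}.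

Definition copy_edges (G K : sgraph) (f : G -> K) : {set {set K}} :=
  [set f @: e | e : {set G} in edges G].

Definition rainbow (k : nat) (K : sgraph) (c : coloring k K)
    (E : {set {set K}}) : Prop :=
  {in E &, injective c}.

Definition monochromatic (k : nat) (K : sgraph) (c : coloring k K)
    (E : {set {set K}}) : Prop :=
  exists i : 'I_k, {in E, forall e, c e = i}.

Definition has_rainbow_copy (k : nat) (G K : sgraph) (c : coloring k K) : Prop :=
  exists2 f : G -> K, embedding f & rainbow c (copy_edges f).

Definition has_monochromatic_copy (k : nat) (H K : sgraph)
    (c : coloring k K) : Prop :=
  exists2 f : H -> K, embedding f & monochromatic c (copy_edges f).

Definition gallai_ramsey_bound (k : nat) (G H : sgraph) (N : nat) : Prop :=
  k <= 'C(N, 2) /\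
  forall n, N <= n -> forall c : coloring k (complete_graph n), exact c ->
    has_rainbow_copy G c \/ has_monochromatic_copy H c.

(* gr_k(G : H) = N *)
Definition is_gallai_ramsey_number (k : nat) (G H : sgraph) (N : nat) : Prop :=
  gallai_ramsey_bound k G H N /\
  forall M, gallai_ramsey_bound k G H M -> N <= M.

(* Main.v *)
Require Import Defs.
From mathcomp Require Import all_boot.
From mathcomp Require Import zify.

(* Upper bound.  If every vertex sees at most two colors, then one color is seen
   by every vertex, and the vertices seeing the second color i are disjoint sets
   for different i; a vertex of the smallest of the three sets has at most n/3
   neighbors outside the dominant color.  Otherwise some vertex a sees three
   colors, and a together with four further vertices spans all four colors.  An
   exhaustive search on these five vertices and two more vertices f, g shows that,
   up to exchanging f and g, all edges from f to the five vertices but at most one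
   have the same color, and that fg has this color too.  Hence f misses at most one
   vertex in that color, which gives a large monochromatic star; in both cases
   two independent edges between the leaves are available.

   Lower bound.  Split 3p + q vertices into residue classes mod 3, use one color
   between the classes and a different one inside each class. *)

Set Implicit Arguments.
Unset Strict Implicit.
Unset Printing Implicit Defensive.

(** * Exhaustive search on seven labelled vertices *)

(* The first three pairs join vertex 0 to three vertices by three different
   colors, and the first ten pairs span the vertices 0, ..., 4. *)
Definition pairs7 : seq (nat * nat) :=
  [:: (0, 1); (0, 2); (0, 3); (1, 2); (1, 3); (2, 3);
      (0, 4); (1, 4); (2, 4); (3, 4);
      (0, 5); (1, 5); (2, 5); (3, 5); (4, 5);
      (0, 6); (1, 6); (2, 6); (3, 6); (4, 6); (5, 6)].

Definition pair_index (u v : nat) : nat :=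
  index (if u < v then (u, v) else (v, u)) pairs7.

Definition edge_color (s : seq nat) (u v : nat) : nat :=
  nth 0 s (pair_index u v).

(** A path on five of the labels is recorded by the indices of its four pairs; comparing its end
    vertices keeps one of the two orientations. *)
Definition paths7 : seq (seq nat) :=
  [seq [:: pair_index v.1.1.1.1 v.1.1.1.2; pair_index v.1.1.1.2 v.1.1.2;
           pair_index v.1.1.2 v.1.2; pair_index v.1.2 v.2]
     | v <- [seq v <- [seq (w, e) | w <- [seq (w, d) | w <- [seq (w, c)
              | w <- [seq (a, b) | a <- iota 0 7, b <- iota 0 7],
                c <- iota 0 7], d <- iota 0 7], e <- iota 0 7]
              | (v.1.1.1.1 < v.2) &&
                uniq [:: v.1.1.1.1; v.1.1.1.2; v.1.1.2; v.1.2; v.2]]].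

(* Grouping the paths by their largest pair index means that a newly colored
   pair is only tested against the paths that it completes. *)
Definition paths_by_last : seq (seq (seq nat)) :=
  [seq [seq l <- paths7 | foldr maxn 0 l == k] | k <- iota 0 21].

Definition completes_rainbow (s : seq nat) : bool :=
  has (fun l => uniq [seq nth 0 s e | e <- l])
      (nth [::] paths_by_last (size s).-1).

Definition majority (s : seq nat) (f i : nat) : bool :=
  4 <= count (fun u => edge_color s u f == i) (iota 0 5).

Definition star_leaves (s : seq nat) (i : nat) : seq nat :=
  [seq u <- [:: 0; 1; 2; 3; 4; 6] | edge_color s u 5 == i].

Definition star_edges (s : seq nat) (i : nat) : seq (nat * nat) :=
  [seq e <- [seq (u, v) | u <- star_leaves s i, v <- star_leaves s i]
     | (e.1 < e.2) && (edge_color s e.1 e.2 == i)].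

Definition star_at5 (s : seq nat) (i : nat) : bool :=
  (edge_color s 5 6 == i) &&
  has (fun e => has (fun e' => uniq [:: e.1; e.2; e'.1; e'.2]) (star_edges s i))
      (star_edges s i).

(** Labels 5 and 6 stand for f and g. The majority is asked of either, its consequences of 5 alone:
    exchanging f and g makes 5 the vertex with the majority. *)
Definition star_forced (s : seq nat) : bool :=
  (has (majority s 5) (iota 0 4) || has (majority s 6) (iota 0 4)) &&
  all (fun i => majority s 5 i ==> star_at5 s i) (iota 0 4).

(* Branches in which color 3 does not occur among the vertices 0, ..., 4 are
   abandoned.  Nested [if] instead of [||], which [vm_compute] evaluates
   strictly on both sides. *)
Fixpoint search (n : nat) (s : seq nat) : bool :=
  if n is n'.+1 then
    all (fun x =>
      let s' := rcons s x in
      if completes_rainbow s' then true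
      else if (size s' == 10) && (3 \notin s') then true
      else search n' s') (iota 0 4)
  else star_forced s.

(** Three of the 21 pairs are colored in advance, so 18 remain. *)
Lemma search_succeeds : search 18 [:: 0; 1; 2].
Proof. by vm_compute. Qed.

(** * Soundness of the search *)

Definition rainbow_P5_free (T : eqType) (C : eqType) (col : T -> T -> C) :=
  forall v0 v1 v2 v3 v4 : T, uniq [:: v0; v1; v2; v3; v4] ->
  ~~ uniq [:: col v0 v1; col v1 v2; col v2 v3; col v3 v4].

(** The search is followed along the branch given by the entries of [s]. No prefix completes a
    rainbow path and color 3 occurs in the first ten entries, so neither cut-off applies and the
    branch reaches its leaf. *)
Lemma search_sound n k s : k + n = size s -> all (gtn 4) s ->
    3 \in take 10 s ->
    (forall j, k < j <= size s -> ~~ completes_rainbow (take j s)) ->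
  search n (take k s) -> star_forced s.
Proof.
elim: n k => [|n IHn] k; first by rewrite addn0 => -> _ _ _; rewrite take_size.
move=> ks lt4 in3 Nref found.
have lt_ks : k < size s by lia.
have: nth 0 s k \in iota 0 4.
  by have := mem_nth 0 lt_ks; rewrite mem_iota; move/allP: lt4 => /[apply].
have /allP := found : all _ (iota 0 4); move=> /[apply] /=.
rewrite -take_nth // (negPf (Nref _ _)) ?ltnSn //.
rewrite size_takel //.
have -> : (k.+1 == 10) && (3 \notin take k.+1 s) = false.
  by case: eqP => // ->; rewrite in3.
by apply: IHn => // [|j ?]; [lia | apply: Nref; lia].
Qed.

Lemma pair_index_mem u v : u < 7 -> v < 7 -> u != v ->
  (if u < v then (u, v) else (v, u)) \in pairs7.
Proof.
have: all (fun u => all (fun v =>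
  (u == v) || ((if u < v then (u, v) else (v, u)) \in pairs7)) (iota 0 7)) (iota 0 7).
  by vm_compute.
move=> /allP H u7 v7 uv.
have /allP/(_ v) := H u ltac:(by rewrite mem_iota).
by rewrite mem_iota v7 (negPf uv); apply.
Qed.

Definition colors7 (col : nat -> nat -> nat) : seq nat :=
  [seq col e.1 e.2 | e <- pairs7].

Lemma edge_colorE col u v : (forall x y, col x y = col y x) ->
  u < 7 -> v < 7 -> u != v -> edge_color (colors7 col) u v = col u v.
Proof.
move=> colC u7 v7 uv; have mem := pair_index_mem u7 v7 uv.
rewrite /edge_color /pair_index (nth_map (0, 0)) ?index_mem // nth_index //.
by case: ifP => // _; rewrite colC.
Qed.

Lemma paths7P l : l \in paths7 -> exists v0 v1 v2 v3 v4,
  [/\ all (gtn 7) [:: v0; v1; v2; v3; v4], uniq [:: v0; v1; v2; v3; v4]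
    & l = [:: pair_index v0 v1; pair_index v1 v2; pair_index v2 v3;
              pair_index v3 v4]].
Proof.
case/mapP=> v; rewrite mem_filter => /andP[/andP[_ uniq_v] mem_v] ->.
case: v uniq_v mem_v => [[[[v0 v1] v2] v3] v4] uniq_v mem_v.
exists v0, v1, v2, v3, v4; split=> //; move: mem_v => {uniq_v}.
case/allpairsPdep=> w [e [+ m4 [def_w ->]]]; rewrite -def_w.
case/allpairsPdep=> w' [d [+ m3 [def_w' ->]]]; rewrite -def_w'.
case/allpairsPdep=> w'' [c [+ m2 [def_w'' ->]]]; rewrite -def_w''.
case/allpairsPdep=> a [b [m0 m1 [-> ->]]].
by move: m0 m1 m2 m3 m4; rewrite !mem_iota /= => -> -> -> -> ->.
Qed.

(** A path with largest pair index [k - 1] uses only pairs colored in the prefix of length [k], so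
    the values read there are true colors and not the default of [nth]. *)
Lemma completes_rainbow_free col k : (forall x y, col x y = col y x) -> 0 < k <= 21 ->
    (forall v0 v1 v2 v3 v4, all (gtn 7) [:: v0; v1; v2; v3; v4] ->
       uniq [:: v0; v1; v2; v3; v4] ->
       ~~ uniq [:: col v0 v1; col v1 v2; col v2 v3; col v3 v4]) ->
  ~~ completes_rainbow (take k (colors7 col)).
Proof.
move=> colC k21 free; apply/negP => /hasP[l].
rewrite size_takel ?size_map //; last by case/andP: k21.
rewrite (nth_map 0) ?size_iota; last by lia.
rewrite mem_filter nth_iota ?add0n; last by lia.
case/andP=> /eqP max_l /paths7P[v0 [v1 [v2 [v3 [v4 [lt7 uniq_v def_l]]]]]].
suff -> : [seq nth 0 (take k (colors7 col)) e | e <- l] =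
          [:: col v0 v1; col v1 v2; col v2 v3; col v3 v4].
  by apply/negP/free.
have lt_k e : e \in l -> e < k.
  move=> le; suff : e <= foldr maxn 0 l by rewrite max_l; lia.
  elim: (l) le => //= x l' IHl; rewrite inE leq_max => /predU1P[-> | /IHl ->].
    by rewrite leqnn.
  by rewrite orbT.
transitivity [seq nth 0 (colors7 col) e | e <- l].
  by apply/eq_in_map => e /lt_k lt_ek; rewrite nth_take.
move: lt7 uniq_v; rewrite def_l /= !inE !negb_or /=.
move=> /and5P[? ? ? ? /andP[? _]].
move=> /and5P[/and4P[? _ _ _] /and3P[? _ _] /andP[? _] ? _].
have ecE m n : m < 7 -> n < 7 -> m != n ->
    nth 0 (colors7 col) (pair_index m n) = col m n := @edge_colorE col m n colC.
by congr [:: _; _; _; _]; exact: ecE.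
Qed.

Lemma seven_labels (col : nat -> nat -> nat) :
    (forall x y, col x y = col y x) -> (forall x y, col x y < 4) ->
    (forall v0 v1 v2 v3 v4, all (gtn 7) [:: v0; v1; v2; v3; v4] ->
       uniq [:: v0; v1; v2; v3; v4] ->
       ~~ uniq [:: col v0 v1; col v1 v2; col v2 v3; col v3 v4]) ->
    col 0 1 = 0 -> col 0 2 = 1 -> col 0 3 = 2 ->
    (exists u v, [/\ u < v, v < 5 & col u v = 3]) ->
  star_forced (colors7 col).
Proof.
move=> colC col4 free c01 c02 c03 [u [v [uv v5 cuv]]].
have take3 : take 3 (colors7 col) = [:: 0; 1; 2] by rewrite /= c01 c02 c03.
have lt4 : all (gtn 4) (colors7 col).
  by apply/allP => _ /mapP[e _ ->]; rewrite /= col4.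
have in3 : 3 \in take 10 (colors7 col).
  have: (u, v) \in take 10 pairs7.
    by move: u v uv v5 {cuv} => [|[|[|[|u]]]] [|[|[|[|[|v]]]]].
  by move/(map_f (fun e => col e.1 e.2)); rewrite map_take /= cuv.
(* [found] must not stay in the context: [done] would unfold the search. *)
pose found := eq_ind_r (fun s0 => search 18 s0) search_succeeds take3.
refine (search_sound _ lt4 in3 _ found); clear found; first by rewrite size_map.
by move=> j; rewrite size_map [size _]/= => j21; apply: completes_rainbow_free => //; lia.
Qed.

(** * Transfer of the search to arbitrary vertices and colors *)

Lemma mem_uniq4 (cs : seq 'I_4) : uniq cs -> size cs = 4 -> forall i, i \in cs.
Proof.
move=> cs_uniq cs4 i; have := subset_cardP _ (subset_predT (mem cs)).
by rewrite card_ord (card_uniqP cs_uniq) => /(_ cs4) ->.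
Qed.

(** Vertices are renamed by their position in [s] and colors by their position in [cs]. Then ab, ac,
    ad get colors 0, 1, 2 and [w] becomes 3, as the search assumes. *)
Lemma seven_vertices (T : eqType) (col : T -> T -> 'I_4) (a b c d e f g : T)
    (w : 'I_4) (B := [:: a; b; c; d; e]) :
    (forall x y, col x y = col y x) -> rainbow_P5_free col ->
    uniq [:: a; b; c; d; e; f; g] ->
    uniq [:: col a b; col a c; col a d; w] ->
    (exists u v, [/\ u \in B, v \in B, u != v & col u v = w]) ->
  (exists i, 4 <= count (fun u => col u f == i) B \/
             4 <= count (fun u => col u g == i) B) /\
  forall i, 4 <= count (fun u => col u f == i) B ->
    col f g = i /\ exists x1 x2 x3 x4,
      [/\ uniq [:: x1; x2; x3; x4], {subset [:: x1; x2; x3; x4] <= g :: B},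
          all (fun x => col x f == i) [:: x1; x2; x3; x4],
          col x1 x2 = i & col x3 x4 = i].
Proof.
move=> colC free s_uniq cs_uniq [u [v [uB vB uv cuv]]].
set s := [:: a; b; c; d; e; f; g] in s_uniq.
set cs := [:: _; _; _; _] in cs_uniq.
have csT := mem_uniq4 cs_uniq erefl.
have h_inj i j : (index i cs == index j cs) = (i == j).
  apply/eqP/eqP => [eq_ij | -> //].
  by rewrite -(nth_index w (csT i)) -(nth_index w (csT j)) eq_ij.
pose col' m n := index (col (nth a s m) (nth a s n)) cs.
have colC' m n : col' m n = col' n m by rewrite /col' colC.
have col4 m n : col' m n < 4 by rewrite /col' index_mem csT.
have def_B : B = [seq nth a s m | m <- iota 0 5] by [].
have idx0 : index (col a b) cs = 0 by exact: (@index_uniq _ w 0 cs).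
have idx1 : index (col a c) cs = 1 by exact: (@index_uniq _ w 1 cs).
have idx2 : index (col a d) cs = 2 by exact: (@index_uniq _ w 2 cs).
have idx3 : index w cs = 3 by exact: (@index_uniq _ w 3 cs).
have tgt : star_forced (colors7 col').
  apply: seven_labels => //.
    move=> v0 v1 v2 v3 v4 lt7 v_uniq.
    set P := [:: v0; v1; v2; v3; v4] in lt7 v_uniq.
    have /free : uniq [seq nth a s m | m <- P].
      rewrite map_inj_in_uniq // => m n /(allP lt7) m7 /(allP lt7) n7 /eqP.
      by rewrite nth_uniq // => /eqP.
    apply: contraNN => unq.
    by rewrite -(map_inj_uniq (f := index ^~ cs)) // => i j /eqP; rewrite h_inj => /eqP.
  move: uB vB; rewrite def_B.
  move=> /mapP[m + def_u] /mapP[n + def_v]; rewrite !mem_iota /= => m5 n5.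
  have mn : m != n by apply: contraNneq uv => mn; rewrite def_u def_v mn.
  have [lt_mn|le_nm] := ltnP m n; [exists m, n | exists n, m]; split=> //.
  - by rewrite /col' -def_u -def_v cuv.
  - by rewrite ltn_neqAle eq_sym mn.
  - by rewrite /col' -def_u -def_v colC cuv.
have ecE m n : m < 7 -> n < 7 -> m != n ->
    edge_color (colors7 col') m n = index (col (nth a s m) (nth a s n)) cs.
  by move=> *; rewrite edge_colorE.
have majE n i : n < 7 -> 5 <= n -> majority (colors7 col') n (index i cs) =
    (4 <= count (fun u => col u (nth a s n) == i) B).
  move=> n7 n5; rewrite /majority def_B count_map; congr (_ <= _).
  apply/eq_in_count => m; rewrite mem_iota /= => m5; rewrite ecE ?h_inj //; lia.
case/andP: tgt => maj /allP star; split.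
  have ex n : 5 <= n < 7 -> has (majority (colors7 col') n) (iota 0 4) ->
      exists i, 4 <= count (fun u => col u (nth a s n) == i) B.
    move=> /andP[n5 n7] /hasP[j]; rewrite mem_iota /= => j4.
    rewrite -(index_uniq w (j4 : j < size cs) cs_uniq) majE // => H.
    by exists (nth w cs j).
  by case/orP: maj => /ex-/(_ isT)[i Hi]; exists i; [left | right].
move=> i; rewrite -(majE 5 i) // => maj5.
have /star : index i cs \in iota 0 4 by rewrite mem_iota /= (index_mem i cs) csT.
rewrite maj5 implyTb /star_at5 => /andP[/eqP]; rewrite ecE // => /eqP.
rewrite h_inj => /eqP cfg.
pose N :=  star_leaves (colors7 col') (index i cs).
have N7 m : m \in N -> [/\ m < 7, nth a s m \in g :: B & col (nth a s m) f = i].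
  rewrite mem_filter andbC => /andP[m_in].
  have [m7 m5 mB] : [/\ m < 7, m != 5 & nth a s m \in g :: B].
    by move: m_in; rewrite !inE => /or4P[|||/or3P[||]] /eqP ->; rewrite /= eqxx ?orbT.
  by rewrite ecE // h_inj => /eqP.
case/hasP=> -[m1 m2] m12 /hasP[[m3 m4]] m34 /= m_uniq; split=> //.
exists (nth a s m1), (nth a s m2), (nth a s m3), (nth a s m4).
have MP m n : (m, n) \in star_edges (colors7 col') (index i cs) ->
    [/\ m \in N, n \in N & col (nth a s m) (nth a s n) = i].
  rewrite mem_filter => /andP[/andP[lt_mn /eqP cmn] /allpairsPdep].
  case=> m' [n' [mN nN [def_m def_n]]].
  rewrite -{m'}def_m in mN; rewrite -{n'}def_n in nN.
  have [[m7 _ _] [n7 _ _]] := (N7 _ mN, N7 _ nN).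
  move: cmn; rewrite ecE //; last by rewrite neq_ltn lt_mn.
  by move/eqP; rewrite h_inj => /eqP.
have [n1 n2 c12] := MP _ _ m12; have [n3 n4 c34] := MP _ _ m34.
have [? b1 c1] := N7 _ n1; have [? b2 c2] := N7 _ n2.
have [? b3 c3] := N7 _ n3; have [? b4 c4] := N7 _ n4.
split=> //.
- suff: uniq [seq nth a s m | m <- [:: m1; m2; m3; m4]] by [].
  rewrite map_inj_in_uniq //.
  have lt7 : all (gtn 7) [:: m1; m2; m3; m4] by apply/and5P.
  move=> m n /(allP lt7) m7 /(allP lt7) n7 /eqP.
  by rewrite nth_uniq // => /eqP.
- apply/allP; rewrite /= b1 b2 b3 b4 //.
- by rewrite /= c1 c2 c3 c4 eqxx.
Qed.

(** * Large stars from a vertex that sees three colors *)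

Definition color_nbhd (T : finType) (col : T -> T -> 'I_4) (v : T) (i : 'I_4) :=
  [set u | (u != v) && (col v u == i)].

(** A monochromatic star with at least [m] leaves and two independent edges of its color between
    them, hence $S_{m+1}^2$ and $S_{m+1}^1$. *)
Definition has_star2 (T : finType) (col : T -> T -> 'I_4) (m : nat) :=
  exists v i x1 x2 x3 x4,
    [/\ m <= #|color_nbhd col v i|, uniq [:: x1; x2; x3; x4],
        {subset [:: x1; x2; x3; x4] <= color_nbhd col v i},
        col x1 x2 = i & col x3 x4 = i].

Definition sees (T : finType) (col : T -> T -> 'I_4) (v : T) (i : 'I_4) :=
  [exists u, (u != v) && (col v u == i)].

Lemma count_but_one (T : eqType) (P : pred T) (a b c d e : T) :
    4 <= count P [:: a; b; c; d; e] ->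
  exists z, forall u, u \in [:: a; b; c; d; e] -> u != z -> P u.
Proof.
(* If [P] holds at all five, [z] is the default [a], which does no harm. *)
move=> cnt; pose z := nth a [:: a; b; c; d; e] (find (predC P) [:: a; b; c; d; e]).
exists z => u; rewrite {}/z; move: cnt => /=.
case Pa: (P a); case Pb: (P b); case Pc: (P c); case Pd: (P d); case Pe: (P e) => //= _;
  rewrite !inE => /or4P[|||/orP[]] /eqP ->; by rewrite ?Pa ?Pb ?Pc ?Pd ?Pe ?eqxx.
Qed.

Lemma exists_notin (T : finType) (s : seq T) :
  size s < #|T| -> exists x, x \notin s.
Proof.
move=> lt_s; apply/existsP; apply: contraLR lt_s => /existsPn all_in.
rewrite -leqNgt; apply: leq_trans (card_size s).
by apply/subset_leq_card/subsetP => x _; have := all_in x; rewrite negbK.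
Qed.

(** A first pair outside B provides f with a majority color i. With f fixed, g then runs through all
    other vertices outside B, and each edge fg has color i. *)
Lemma has_star2_of_seven (T : finType) (col : T -> T -> 'I_4) (a b c d e : T)
    (w : 'I_4) (B := [:: a; b; c; d; e]) :
    7 <= #|T| -> (forall x y, col x y = col y x) -> rainbow_P5_free col ->
    uniq B -> uniq [:: col a b; col a c; col a d; w] ->
    (exists u v, [/\ u \in B, v \in B, u != v & col u v = w]) ->
  has_star2 col (#|T| - 2).
Proof.
move=> T7 colC free B_uniq cs_uniq Bw.
have out f : exists g, g \notin f :: B by apply: exists_notin.
have uniq7 f g : f \notin B -> g \notin f :: B -> uniq [:: a; b; c; d; e; f; g].
  move=> fB; rewrite inE negb_or eq_sym => /andP[fg gB].
  have noB : ~~ has (mem B) [:: f; g].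
    by apply/hasPn => x; rewrite mem_seq2 => /orP[] /eqP ->.
  have : uniq (B ++ [:: f; g]) by rewrite cat_uniq B_uniq noB /= mem_seq1 fg.
  by [].
have [f1] := out a; rewrite inE negb_or => /andP[_ f1B].
have [g1 g1B] := out f1.
have [i [f [fB maj]]] : exists i f, f \notin B /\ 4 <= count (fun u => col u f == i) B.
  have [[i maj] _] := seven_vertices colC free (uniq7 _ _ f1B g1B) cs_uniq Bw.
  exists i; case: maj => maj; [by exists f1 | exists g1; split=> //].
  by move: g1B; rewrite inE negb_or => /andP[].
have toB g : g \notin f :: B -> col f g = i /\ exists x1 x2 x3 x4,
      [/\ uniq [:: x1; x2; x3; x4], {subset [:: x1; x2; x3; x4] <= g :: B},
          all (fun x => col x f == i) [:: x1; x2; x3; x4],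
          col x1 x2 = i & col x3 x4 = i].
  by move=> gB; apply: (seven_vertices colC free (uniq7 _ _ fB gB) cs_uniq Bw).2.
have [z Hz] := count_but_one maj.
have [g gB] := out f.
have [_ [x1 [x2 [x3 [x4 [x_uniq xB x_f c12 c34]]]]]] := toB g gB.
exists f, i, x1, x2, x3, x4; split=> //.
  (* Only f itself and the exceptional vertex z can be missing from the neighborhood, whence the
     2. *)
  rewrite leq_subLR -(cardC (mem [:: f; z])) leq_add ?card_size //.
  apply/subset_leq_card/subsetP => u; rewrite !inE negb_or => /andP[uf uz].
  rewrite uf /=; have [uB | uB] := boolP (u \in B).
    by rewrite colC; apply: Hz.
  by have [-> _] := toB u ltac:(by rewrite inE negb_or uf).
move=> x x_in; rewrite inE; move/allP: x_f => /(_ x x_in); rewrite colC => ->.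
rewrite andbT; apply: contraNneq gB => xf; rewrite -xf in fB *.
by have := xB x x_in; rewrite in_cons (negPf fB) orbF => /eqP ->; exact: mem_head.
Qed.

Lemma four_colors (p q : 'I_4) : p != q -> exists r s, uniq [:: p; q; r; s].
Proof.
move=> pq; have : 1 < #|~: [set p; q]| by rewrite cardsCs setCK cards2 pq card_ord.
case/card_gt1P=> r [s []]; rewrite !inE !negb_or => /andP[rp rq] /andP[sp sq] rs.
by exists r, s; rewrite /= !inE !negb_or pq rs !(eq_sym p) !(eq_sym q) rp rq sp sq.
Qed.

(** A fifth vertex is needed so that the fourth color w occurs among the five. If a sees w, a
    w-neighbor of a serves. Otherwise an edge uv of color w avoids a; the color of au is one of the
    other three, so u can replace one of b, c, d, and v is added. *)
Lemma has_star2_of_three_colors (T : finType) (col : T -> T -> 'I_4)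
    (a b c d : T) :
    7 <= #|T| -> (forall x y, col x y = col y x) -> rainbow_P5_free col ->
    (forall i, exists x y, x != y /\ col x y = i) ->
    a \notin [:: b; c; d] -> uniq [:: col a b; col a c; col a d] ->
  has_star2 col (#|T| - 2).
Proof.
move=> T7 colC free ex aB cs_uniq.
have [w ws] : exists w, w \notin [:: col a b; col a c; col a d].
  by apply: exists_notin; rewrite card_ord.
have uniq_ws b' c' d' : col a b' = col a b -> col a c' = col a c ->
    col a d' = col a d -> uniq [:: col a b'; col a c'; col a d'; w].
  move=> -> -> ->; have : uniq (rcons [:: col a b; col a c; col a d] w).
    by rewrite rcons_uniq ws.
  by [].
have uniqB b' c' d' e : col a b' = col a b -> col a c' = col a c ->
    col a d' = col a d -> a \notin [:: b'; c'; d'] -> e \notin [:: a; b'; c'; d'] ->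
    uniq [:: a; b'; c'; d'; e].
  move=> eb ec ed aB' eB'.
  have : uniq (rcons [:: a; b'; c'; d'] e).
    rewrite rcons_uniq eB' cons_uniq aB' !andTb.
    by apply: (@map_uniq _ _ (col a)); rewrite [map _ _]/= eb ec ed.
  by [].
have [sees_w | not_w] := boolP [exists u, (u != a) && (col a u == w)].
  case/existsP: sees_w => u /andP[ua /eqP au].
  apply: (@has_star2_of_seven _ _ a b c d u w) => //; try exact: uniq_ws.
    apply: uniqB => //; rewrite in_cons negb_or ua.
    apply: contra ws; rewrite -au; exact: (@map_f _ _ (col a) [:: b; c; d]).
  by exists a, u; split; rewrite // ?[a == u]eq_sym // !inE eqxx ?orbT.
have Nw u : u != a -> col a u != w.
  by move=> ua; apply: contra not_w => uw; apply/existsP; exists u; rewrite ua.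
have [u [v [uv cuv]]] := ex w.
have ua : u != a by apply/eqP => ua; have := Nw v; rewrite -ua eq_sym uv cuv eqxx => /(_ isT).
have va : v != a.
  by apply/eqP => va; have := Nw u; rewrite -va uv colC cuv eqxx => /(_ isT).
(* [rep] exchanges x for u exactly when both are joined to a by the same color. *)
have rep x : x != a -> exists x', [/\ x' != a, col a x' = col a x
    & col a u = col a x -> x' = u].
  move=> xa; have [eq_ux|/eqP neq_ux] := eqVneq (col a u) (col a x).
    by exists u.
  by exists x; split.
move: (aB); rewrite !inE !negb_or !(eq_sym a) => /and3P[ba ca da].
have [b' [b'a b'c b'u]] := rep b ba; have [c' [c'a c'c c'u]] := rep c ca.
have [d' [d'a d'c d'u]] := rep d da.
have aB' : a \notin [:: b'; c'; d'] by rewrite !inE !negb_or !(eq_sym a) b'a c'a.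
(* The fifth vertex is v, or an arbitrary one if v is already present. *)
have [e [eB' ve]] : exists e, e \notin [:: a; b'; c'; d'] /\ v \in [:: e; a; b'; c'; d'].
  have [vB' | vB'] := boolP (v \in [:: a; b'; c'; d']).
    have [e eB'] : exists e, e \notin [:: a; b'; c'; d'].
      by apply: exists_notin; apply: leq_trans T7.
    by exists e; rewrite eB' in_cons vB' orbT.
  by exists v; rewrite vB' mem_head.
apply: (@has_star2_of_seven _ _ a b' c' d' e w) => //.
- exact: uniqB.
- exact: uniq_ws.
exists u, v; split=> //.
  have : col a u \in [:: col a b; col a c; col a d].
    have := mem_uniq4 (uniq_ws b c d erefl erefl erefl) erefl (col a u).
    by rewrite !inE (negPf (Nw u ua)) orbF.
  by rewrite !inE => /or3P[] /eqP; [move/b'u | move/c'u | move/d'u] => <-;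
    rewrite eqxx ?orbT.
by move: ve; rewrite !inE => /or4P[|||/orP[]] /eqP ->; rewrite eqxx ?orbT.
Qed.

(** * Colorings with at most two colors at each vertex *)

(* The sets of colors seen at the vertices have size at most 2 and intersect
   pairwise; as four colors occur they form a star, not a triangle. *)
Lemma local2_dominant (T : finType) (col : T -> T -> 'I_4) :
    (forall x y, col x y = col y x) ->
    (forall i, exists x y, x != y /\ col x y = i) ->
    (forall a b c d, a \notin [:: b; c; d] ->
       ~~ uniq [:: col a b; col a c; col a d]) ->
  exists p, forall v, sees col v p.
Proof.
move=> colC ex loc2.
have seesI x y : x != y -> sees col x (col x y).
  by move=> xy; apply/existsP; exists y; rewrite eq_sym xy /=.
have see3 v i j k : sees col v i -> sees col v j -> sees col v k -> ~~ uniq [:: i; j; k].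
  case/existsP=> x /andP[xv /eqP <-] /existsP[y /andP[yv /eqP <-]].
  case/existsP=> z /andP[zv /eqP <-]; apply: loc2.
  by rewrite !inE !negb_or !(eq_sym v) xv yv.
have see2 v i j k : i != j -> sees col v i -> sees col v j -> sees col v k ->
    k = i \/ k = j.
  move=> ij vi vj vk; have := see3 v k i j vk vi vj.
  by rewrite /= !inE ij !andbT negbK => /orP[] /eqP; [left | right].
(* A vertex y not seeing p would be joined to v, u, u' by q, r, s, and so see three colors. *)
have core p q r s v u u' : uniq [:: p; q; r; s] -> sees col v p -> sees col v q ->
    sees col u p -> sees col u r -> sees col u' p -> sees col u' s ->
    forall y, sees col y p.
  rewrite /= !inE !negb_or => /and4P[/and3P[pq pr ps] /andP[qr qs] rs _].
  move=> vp vq up ur u'p u's y; apply: contraT => Nyp.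
  have via x k : p != k -> sees col x p -> sees col x k -> sees col y k.
    move=> pk xp xk; have yx : y != x by apply: contraNneq Nyp => ->.
    have xy : x != y by rewrite eq_sym.
    have := seesI _ _ yx; rewrite (colC y x).
    by case: (see2 _ _ _ _ pk xp xk (seesI _ _ xy)) => -> // yp; rewrite yp in Nyp.
  have := see3 y q r s (via _ _ pq vp vq) (via _ _ pr up ur) (via _ _ ps u'p u's).
  by rewrite /= !inE !negb_or qr qs rs.
(* Take an edge at x of color 0 and one at z of color 3: if x and z differ, the color of xz gives a
   second color at x or at z. *)
have [v [p [q [pq vp vq]]]] : exists v p q, [/\ p != q, sees col v p & sees col v q].
  have [x [y [xy cxy]]] := ex ord0; have [z [w [zw czw]]] := ex ord_max.
  have x0 := seesI _ _ xy; have z3 := seesI _ _ zw; rewrite cxy in x0; rewrite czw in z3.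
  have [xz|xz] := eqVneq x z; first by exists x, ord0, ord_max; rewrite {2}xz.
  have [cxz|cxz] := eqVneq (col x z) ord0.
    exists z, ord0, ord_max; split=> //; rewrite -cxz colC; apply: seesI.
    by rewrite eq_sym.
  by exists x, (col x z), ord0; split=> //; apply: seesI.
have [r [s pqrs]] := four_colors pq.
have other k : k != p -> k != q -> exists u,
    [/\ u != v, sees col u k, sees col u (col u v) & col u v = p \/ col u v = q].
  move=> kp kq; have [u [w [uw cuw]]] := ex k.
  have uk := seesI _ _ uw; rewrite cuw in uk.
  have uv : u != v.
    apply/eqP => uv; rewrite uv in uk.
    by case: (see2 v p q k pq vp vq uk) => e; rewrite e eqxx in kp kq.
  exists u; split=> //; first exact: seesI.
  by rewrite colC; apply: (see2 v) => //; apply: seesI; rewrite eq_sym.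
have := pqrs; rewrite /= !inE !negb_or => /and4P[/and3P[_ pr ps] /andP[qr qs] rs _].
have [u [uv ur u_uv cuv]] := other r ltac:(by rewrite eq_sym) ltac:(by rewrite eq_sym).
have [u' [u'v u's u'_uv cu'v]] := other s ltac:(by rewrite eq_sym) ltac:(by rewrite eq_sym).
(* This excludes the triangle: the color sets {k, r} of u and {k', s} of u' are disjoint, yet both
   contain the color of uu'. *)
have mixed (k k' : 'I_4) : uniq [:: k; k'; r; s] -> sees col u k -> sees col u' k' -> False.
  rewrite /= !inE !negb_or => /and4P[/and3P[kk' kr ks] /andP[k'r k's] _ _] uk u'k'.
  have uu' : u != u'.
    apply/eqP => uu'; rewrite -uu' in u's; have := see3 u k r s uk ur u's.
    by rewrite /= !inE negb_or kr ks rs.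
  have u'u : u' != u by rewrite eq_sym.
  case: (see2 u k r _ kr uk ur (seesI _ _ uu'));
  case: (see2 u' k' s _ k's u'k' u's (seesI _ _ u'u)); rewrite colC => -> e;
    move: kk' kr ks k'r k's rs; rewrite ?e ?eqxx // -?e ?eqxx //.
have qprs : uniq [:: q; p; r; s].
  by rewrite /= !inE !negb_or eq_sym pq pr ps qr qs rs.
case: cuv cu'v u_uv u'_uv => -> [] -> up u'p.
- by exists p; apply: (core p q r s v u u').
- by case: (mixed p q).
- by case: (mixed q p).
- by exists q; apply: (core q p r s v u u').
Qed.

(** Each vertex sees at most one color besides the dominant p, so every edge leaving a set [V j] has
    color p. The center is taken in the smallest of the three sets. *)
Lemma has_star2_of_local2 (T : finType) (col : T -> T -> 'I_4) :
    (forall x y, col x y = col y x) ->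
    (forall i, exists x y, x != y /\ col x y = i) ->
    (forall a b c d, a \notin [:: b; c; d] ->
       ~~ uniq [:: col a b; col a c; col a d]) ->
  has_star2 col (#|T| - #|T| %/ 3).
Proof.
move=> colC ex loc2; have [p see_p] := local2_dominant colC ex loc2.
have see1 v j k : p != j -> p != k -> sees col v j -> sees col v k -> j = k.
  have /existsP[x /andP[xv /eqP cx]] := see_p v.
  move=> pj pk /existsP[y /andP[yv /eqP cy]] /existsP[z /andP[zv /eqP cz]].
  have /loc2 : v \notin [:: x; y; z].
    by rewrite !inE !negb_or !(eq_sym v) xv yv.
  by rewrite /= !inE !negb_or cx cy cz pj pk /= andbT negbK => /eqP.
have link x y : x != y -> sees col x (col x y) /\ sees col y (col x y).
  move=> xy; split; apply/existsP; [exists y | exists x].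
    by rewrite eq_sym xy /=.
  by rewrite xy colC /=.
pose V k := [set v | sees col v k].
have cross j k x y : p != j -> p != k -> j != k -> x \in V j -> y \in V k ->
    x != y /\ col x y = p.
  rewrite !inE => pj pk jk xj yk; have xy : x != y.
    by apply: contraNneq jk => xy; rewrite -xy in yk; apply/eqP; apply: (see1 x).
  split=> //; apply/eqP; rewrite eq_sym; apply: contraNT jk => pc.
  by have [cx cy] := link x y xy; rewrite (see1 x j _ pj pc) // (see1 y k _ pk pc).
have core j k l : uniq [:: p; j; k; l] -> #|V j| <= #|T| %/ 3 ->
    has_star2 col (#|T| - #|T| %/ 3).
  rewrite /= !inE !negb_or => /and4P[/and3P[pj pk pl] /andP[jk jl] kl _] le_j.
  have [v [v' [vv' cv]]] := ex j.
  (* An edge x1x3 of color k and an edge x2x4 of color l lie in the other two sets; the crossing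
     edges x1x2 and x3x4 have color p and are independent. *)
  have [x1 [x3 [x13 c13]]] := ex k; have [x2 [x4 [x24 c24]]] := ex l.
  have [vj _] := link _ _ vv'; have [x1k x3k] := link _ _ x13.
  have [x2l x4l] := link _ _ x24.
  rewrite cv in vj; rewrite c13 in x1k x3k; rewrite c24 in x2l x4l.
  have vV : v \in V j by rewrite inE.
  have {}x1k : x1 \in V k by rewrite inE.
  have {}x3k : x3 \in V k by rewrite inE.
  have {}x2l : x2 \in V l by rewrite inE.
  have {}x4l : x4 \in V l by rewrite inE.
  have [x12 c12] := cross k l x1 x2 pk pl kl x1k x2l.
  have [x34 c34] := cross k l x3 x4 pk pl kl x3k x4l.
  have [x14 _] := cross k l x1 x4 pk pl kl x1k x4l.
  have [x32 _] := cross k l x3 x2 pk pl kl x3k x2l.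
  exists v, p, x1, x2, x3, x4; split=> //.
  - apply: (@leq_trans #|~: V j|); first by rewrite cardsCs setCK leq_sub2l.
    apply/subset_leq_card/subsetP => u; rewrite !inE => uj.
    have vu : v != u by apply: contraNneq uj => <-.
    rewrite eq_sym vu; have [cvv cvu] := link _ _ vu.
    rewrite eq_sym; apply: contraNT uj => pc.
    by rewrite (see1 v j (col v u)).
  - by rewrite /= !inE !negb_or x12 x13 x14 x24 x34 (eq_sym x2) x32.
  - move=> x; rewrite in_cons mem_seq3 inE => x_in.
    suff [m [pm jm xm]] : exists m, [/\ p != m, j != m & x \in V m].
      by have [vx ->] := cross j m v x pj pm jm vV xm; rewrite eq_sym vx /=.
    by case/or4P: x_in => /eqP ->; [exists k | exists l | exists k | exists l].
have [q pq] : exists q, p != q.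
  have [q] := exists_notin (ltac:(by rewrite card_ord) : size [:: p] < #|'I_4|).
  by rewrite mem_seq1 eq_sym; exists q.
have [r [s pqrs]] := four_colors pq.
have := pqrs; rewrite /= !inE !negb_or => /and4P[/and3P[_ pr ps] /andP[qr qs] rs _].
have disj j k : p != j -> p != k -> j != k -> [disjoint V j & V k].
  move=> pj pk jk; apply/pred0P => x /=; apply/negP => /andP[xj xk].
  by have [/eqP] := cross j k x x pj pk jk xj xk.
have sum_le : #|V q| + #|V r| + #|V s| <= #|T|.
  rewrite -cardsUI disjoint_setI0 ?disj // cards0 addn0 -cardsUI.
  rewrite setIUl !disjoint_setI0 ?disj // setU0 cards0 addn0.
  exact: max_card.
have [le_q|lt_q] := leqP #|V q| (#|T| %/ 3); first exact: (core q r s).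
have [le_r|lt_r] := leqP #|V r| (#|T| %/ 3).
  by apply: (core r q s) => //; rewrite /= !inE !negb_or pq pr ps eq_sym qr qs rs.
have [le_s|lt_s] := leqP #|V s| (#|T| %/ 3).
  by apply: (core s q r) => //; rewrite /= !inE !negb_or pq pr ps !(eq_sym s) qr qs rs.
have := divn_eq #|T| 3; have := ltn_pmod #|T| (isT : 0 < 3).
move: sum_le lt_q lt_r lt_s; lia.
Qed.

Lemma has_star2_of_P5_free (T : finType) (col : T -> T -> 'I_4) :
    7 <= #|T| -> (forall x y, col x y = col y x) -> rainbow_P5_free col ->
    (forall i, exists x y, x != y /\ col x y = i) ->
  has_star2 col (#|T| - #|T| %/ 3).
Proof.
move=> T7 colC free ex.
have [loc2 | ] := boolP [forall a, forall b, forall c, forall d,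
    (a \notin [:: b; c; d]) ==> ~~ uniq [:: col a b; col a c; col a d]].
  apply: has_star2_of_local2 => // a b c d; apply/implyP.
  by move: loc2 => /forallP/(_ a)/forallP/(_ b)/forallP/(_ c)/forallP/(_ d).
move=> /forallPn[a /forallPn[b /forallPn[c /forallPn[d]]]].
rewrite negb_imply negbK => /andP[aB cs_uniq].
have [v [i [x1 [x2 [x3 [x4 [le ? ? ? ?]]]]]]] :=
  has_star2_of_three_colors T7 colC free ex aB cs_uniq.
exists v, i, x1, x2, x3, x4; split=> //; apply: leq_trans le.
(* Since |T| is at least 7, its third rounded down is at least 2, so |T| - 2 leaves suffice. *)
by apply: leq_sub2l; rewrite leq_divRL //; lia.
Qed.

(** * From vertex lists to copies of the path and the star *)

Lemma copy_edgesP (G K : sgraph) (f : G -> K) (E : {set K}) :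
  reflect (exists x y, adj x y /\ E = [set f x; f y]) (E \in copy_edges f).
Proof.
apply: (iffP imsetP) => [[e /imsetP[[x y] /= xy ->] ->] | [x [y [xy ->]]]].
  by exists x, y; rewrite imsetU1 imset_set1; split=> //; rewrite inE in xy.
exists [set x; y]; last by rewrite imsetU1 imset_set1.
by apply/imsetP; exists (x, y); rewrite ?inE.
Qed.

Lemma mem_edges (G : sgraph) (x y : G) : adj x y -> [set x; y] \in edges G.
Proof. by move=> xy; apply/imsetP; exists (x, y); rewrite ?inE. Qed.

Lemma rainbow_P5_of_vertices n k (c : coloring k (complete_graph n))
    (v : seq (complete_graph n)) (x0 : complete_graph n) :
    size v = 5 -> uniq v ->
    uniq [seq c [set nth x0 v i; nth x0 v i.+1] | i <- iota 0 4] ->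
  has_rainbow_copy (path_graph 5) c.
Proof.
move=> v5 v_uniq c_uniq; pose f (i : path_graph 5) := nth x0 v (i : 'I_5).
have f_inj : injective f.
  by move=> i j /eqP; rewrite nth_uniq ?v5 // => /eqP/val_inj.
exists f.
  split=> // x y xy; apply/eqP => /f_inj xy'; by rewrite xy' adj_irr in xy.
have edge E : E \in copy_edges f -> exists2 i, i < 4 & E = [set nth x0 v i; nth x0 v i.+1].
  case/copy_edgesP=> x [y [/orP[]/eqP xy ->]]; rewrite /f -xy; [exists x => //|exists y].
  - by have := ltn_ord y; rewrite -xy.
  - by have := ltn_ord x; rewrite -xy.
  - by rewrite setUC.
move=> E F /edge[i i4 ->] /edge[j j4 ->] ceq.
suff -> : i = j by [].
apply/eqP; rewrite -(nth_uniq (c set0) _ _ c_uniq) ?size_map ?size_iota //.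
by rewrite !(nth_map 0) ?size_iota // !nth_iota // !add0n ceq.
Qed.

(** The center 0 goes to v and the leaves 1, 2, 3, 4 to x1, x2, x3, x4, so that the added edges {1,
    2} and {3, 4} fall on the two given edges; the other leaves fill up from the rest of L. *)
Lemma star_copy n t r k (c : coloring k (complete_graph n))
    (v x1 x2 x3 x4 : complete_graph n) (L : {set complete_graph n}) (i : 'I_k) :
    r <= 2 -> t <= #|L|.+1 -> v \notin L -> {in L, forall u, c [set v; u] = i} ->
    uniq [:: x1; x2; x3; x4] -> {subset [:: x1; x2; x3; x4] <= L} ->
    c [set x1; x2] = i -> c [set x3; x4] = i ->
  has_monochromatic_copy (star_graph t r) c.
Proof.
move=> r2 tL vL cL x_uniq xL c12 c34.
pose X := [:: x1; x2; x3; x4]; pose R := [seq u <- enum L | u \notin X].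
have memXR u : (u \in X ++ R) = (u \in L).
  rewrite mem_cat mem_filter mem_enum; case: (boolP (u \in X)) => //=.
  by move/xL.
have XR_uniq : uniq (X ++ R).
  rewrite cat_uniq x_uniq filter_uniq ?enum_uniq // andbT.
  by apply/hasPn => u; rewrite mem_filter => /andP[].
have sizeXR : size (X ++ R) = #|L|.
  by rewrite -(card_uniqP XR_uniq); apply: eq_card.
pose s := v :: X ++ R; pose f (j : star_graph t r) := nth v s (j : 'I_t).
have s_uniq : uniq s by rewrite cons_uniq memXR vL.
have lt_s (j : star_graph t r) : (j : 'I_t) < size s.
  have -> : size s = #|L|.+1 by rewrite -sizeXR.
  exact: leq_trans (ltn_ord j) tL.
have f_inj : injective f.
  by move=> j m /eqP; rewrite nth_uniq ?lt_s // => /eqP/val_inj.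
have arc x y : star_arc r x y -> c [set f x; f y] = i.
  rewrite /f => /orP[/andP[/eqP -> y0] | /and3P[odd_x /eqP y_x y_r]].
    apply: cL; rewrite -memXR; have := lt_s y; move: y0.
    by case: (nat_of_ord y) => // m _ lt_m; exact: (@mem_nth _ v (X ++ R) m lt_m).
  have x13 : x = 1 :> nat \/ x = 3 :> nat.
    by move: odd_x y_r; rewrite y_x; case: (nat_of_ord x) => [|[|[|[|m]]]] //= *; lia.
  by case: x13 => x_eq; rewrite y_x x_eq.
exists f.
  by split=> // x y xy; apply/eqP => /f_inj xy'; rewrite xy' adj_irr in xy.
exists i => E /copy_edgesP[x [y [/orP[xy|xy] ->]]]; first exact: arc.
by rewrite setUC; apply: arc.
Qed.

Lemma rainbow_or_star n t r (c : coloring 4 (complete_graph n)) :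
    7 <= n -> r <= 2 -> t <= (n - n %/ 3).+1 -> exact c ->
  has_rainbow_copy (path_graph 5) c \/ has_monochromatic_copy (star_graph t r) c.
Proof.
move=> n7 r2 tn c_exact; pose col (x y : 'I_n) := c [set x; y].
have colC x y : col x y = col y x by rewrite /col setUC.
have ex i : exists x y, x != y /\ col x y = i.
  have [E /imsetP[[x y] /= xy ->] <-] := c_exact i.
  by exists x, y; split=> //; rewrite inE in xy.
have [x0 _] : exists x0 : complete_graph n, true by have [x _] := ex ord0; exists x.
(* Quantifying over 5-tuples makes the existence of a rainbow path decidable. *)
have [/existsP[P /andP[P_uniq col_uniq]] | noP] :=
  boolP [exists P : 5.-tuple (complete_graph n), uniq P &&
    uniq [seq c [set nth x0 P i; nth x0 P i.+1] | i <- iota 0 4]].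
  by left; apply: rainbow_P5_of_vertices P_uniq col_uniq; rewrite size_tuple.
right; have free : rainbow_P5_free col.
  move=> v0 v1 v2 v3 v4 v_uniq; apply: contra noP => col_uniq.
  by apply/existsP; exists [tuple v0; v1; v2; v3; v4]; apply/andP.
have [v [i [x1 [x2 [x3 [x4 [leL x_uniq xL c12 c34]]]]]]] :=
  has_star2_of_P5_free (ltac:(by rewrite card_ord) : 7 <= #|'I_n|) colC free ex.
rewrite card_ord in leL.
apply: (@star_copy n t r 4 c v _ _ _ _ _ i r2 _ _ _ x_uniq xL c12 c34).
  exact: leq_trans tn _.
  by rewrite inE eqxx.
by move=> u; rewrite inE => /andP[_ /eqP].
Qed.

(** * Lower bound: the coloring by residues mod 3 *)

(** A coloring takes a vertex set, so an endpoint is recovered by [pick]; on an edge the value does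
    not depend on the choice. Color 0 joins different classes and color k + 1 is used inside class
    k. *)
Definition mod3_coloring n : coloring 4 (complete_graph n) := fun e =>
  if [pick x : 'I_n in e] is Some x then
    if [forall (y : 'I_n | y \in e), y %% 3 == x %% 3] then inord (x %% 3).+1 else ord0
  else ord0.

Lemma mod3_coloringE n (x y : 'I_n) :
  mod3_coloring [set x; y] = if x %% 3 == y %% 3 then inord (x %% 3).+1 else ord0.
Proof.
rewrite /mod3_coloring; case: pickP => [z | /(_ x)]; last by rewrite !inE eqxx.
have -> : [forall (t : 'I_n | t \in [set x; y]), t %% 3 == z %% 3] =
          (x %% 3 == z %% 3) && (y %% 3 == z %% 3).
  apply/forall_inP/andP => [H | [xz yz] t]; first by split; apply: H; rewrite !inE eqxx ?orbT.
  by rewrite !inE => /orP[] /eqP ->.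
rewrite !inE => /orP[] /eqP ->; rewrite eqxx ?andbT //=; first by rewrite eq_sym.
by case: eqP => // ->.
Qed.

Lemma mod3_exact n : 6 <= n -> exact (@mod3_coloring n).
Proof.
move=> n6 i; have o k : k < 6 -> k < n by move=> /leq_trans; apply.
have wit (x y : 'I_n) : x != y -> mod3_coloring [set x; y] = i ->
    exists2 e, e \in edges (complete_graph n) & mod3_coloring e = i.
  by move=> xy cxy; exists [set x; y] => //; apply: mem_edges.
have [i0 | i_gt0] := posnP i.
  apply: (wit (Ordinal (o 0 isT)) (Ordinal (o 1 isT))) => //.
  by rewrite mod3_coloringE; apply/val_inj.
have i4 := ltn_ord i; have lt1 : i.-1 < n by lia.
have lt2 : i.-1 + 3 < n by lia.
(* A color i > 0 occurs on the edge from i - 1 to i + 2, inside class i - 1. *)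
apply: (wit (Ordinal lt1) (Ordinal lt2)); first by rewrite -val_eqE /=; lia.
rewrite mod3_coloringE /= modnDr eqxx modn_small; last by lia.
by rewrite prednK // inord_val.
Qed.

(** Two consecutive edges of nonzero color stay in one class and share their color. Hence each half
    of a rainbow path would contain an edge of color 0, a repetition. *)
Lemma mod3_no_rainbow n : ~ has_rainbow_copy (path_graph 5) (@mod3_coloring n).
Proof.
case=> f [f_inj f_homo] rb; pose g i : 'I_n := f (inord i : 'I_5).
have ge i : i < 4 -> [set g i; g i.+1] \in copy_edges f.
  move=> i4; apply/copy_edgesP; exists (inord i), (inord i.+1); split=> //.
  by apply/orP; left; rewrite !inordK //; lia.
have same i : i.+1 < 4 -> mod3_coloring [set g i; g i.+1] != ord0 ->
    mod3_coloring [set g i.+1; g i.+2] != ord0 -> False.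
  move=> i3; rewrite !mod3_coloringE.
  case: (g i %% 3 =P g i.+1 %% 3) => [e1 _ | _]; last by rewrite eqxx.
  case: (g i.+1 %% 3 =P g i.+2 %% 3) => [e2 _ | _]; last by rewrite eqxx.
  have := rb _ _ (ge i (ltnW i3)) (ge i.+1 i3).
  rewrite !mod3_coloringE e1 e2 !eqxx => /(_ erefl)/setP/(_ (g i)).
  rewrite !inE eqxx /= => /esym/orP[] /eqP/f_inj/(congr1 (@nat_of_ord 5));
    rewrite !inordK //; lia.
have [i [i2 ci]] : exists i, i < 2 /\ mod3_coloring [set g i; g i.+1] = ord0.
  have [c0|c0] := eqVneq (mod3_coloring [set g 0; g 1]) ord0; first by exists 0.
  have [c1|c1] := eqVneq (mod3_coloring [set g 1; g 2]) ord0; first by exists 1.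
  by case: (same 0).
have [j [j2 j4 cj]] : exists j, [/\ 1 < j, j < 4 & mod3_coloring [set g j; g j.+1] = ord0].
  have [c0|c0] := eqVneq (mod3_coloring [set g 2; g 3]) ord0; first by exists 2.
  have [c1|c1] := eqVneq (mod3_coloring [set g 3; g 4]) ord0; first by exists 3.
  by case: (same 2).
have := rb _ _ (ge i (leq_trans i2 (isT : 2 <= 4))) (ge j j4).
rewrite ci cj => /(_ erefl)/setP/(_ (g i)).
rewrite !inE eqxx /= => /esym/orP[] /eqP/f_inj/(congr1 (@nat_of_ord 5));
    rewrite !inordK //; lia.
Qed.

Lemma card_mod3 n p k : k < 3 -> 3 * p <= n -> p <= #|[set x : 'I_n | x %% 3 == k]|.
Proof.
move=> k3 pn; have lt (j : 'I_p) : 3 * j + k < n by have := ltn_ord j; lia.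
pose h j := Ordinal (lt j).
have h_inj : injective h by move=> i j /(congr1 val) /= ?; apply/val_inj => /=; lia.
rewrite -[p in p <= _]card_ord -(card_imset _ h_inj).
apply/subset_leq_card/subsetP => _ /imsetP[j _ ->].
by rewrite inE /= mulnC modnMDl modn_small.
Qed.

(** All t - 1 leaves avoid some class, which has at least p vertices: the class of the center if the
    color is 0, and the next class otherwise. So t - 1 <= n - p. *)
Lemma mod3_no_star n p t r : 3 * p <= n -> n < t + p - 1 ->
  ~ has_monochromatic_copy (star_graph t r) (@mod3_coloring n).
Proof.
move=> pn nt [f [f_inj f_homo] [i mono]].
have t_gt0 : 0 < t by lia.
pose o : 'I_t := Ordinal t_gt0.
have co (x : 'I_t) : x != o -> mod3_coloring [set (f o : 'I_n); f x] = i.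
  move=> xo; apply: mono; apply/copy_edgesP; exists o, x; split=> //.
  by apply/orP; left; rewrite /star_arc /= xo.
have [k [k3 kP]] : exists k, k < 3 /\ forall x : 'I_t, x != o -> (f x : 'I_n) %% 3 != k.
  have [i0 | i0] := eqVneq i ord0.
    exists ((f o : 'I_n) %% 3); split; first by rewrite ltn_mod.
    move=> x /co; rewrite mod3_coloringE i0 eq_sym; case: eqP => // _ /(congr1 val).
    by rewrite /= inordK // ltnS ltn_mod.
  exists ((f o : 'I_n).+1 %% 3); split; first by rewrite ltn_mod.
  move=> x /co; rewrite mod3_coloringE; case: eqP => [<- _ | _ /esym/eqP].
    by case: (f o) => m /= _; lia.
  by rewrite (negPf i0).
have sub : f @: [set~ o] \subset ~: [set x : 'I_n | x %% 3 == k].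
  by apply/subsetP => _ /imsetP[x + ->]; rewrite !inE; apply: kP.
have := subset_leq_card sub; have := card_mod3 k3 pn.
rewrite (card_imset _ f_inj) cardsC1 [#|~: _|]cardsCs setCK !card_ord.
by move=> le_p /leq_trans/(_ (leq_sub2l n le_p)); lia.
Qed.

(** * The value of the Gallai-Ramsey number *)

Theorem theorem3p2 (t r p q : nat) (ht : 6 <= t) (hr : r = 1 \/ r = 2)
    (hq : q = 0 \/ q = 1) (htpq : t - 2 = 2 * p + q) :
  is_gallai_ramsey_number 4 (path_graph 5) (star_graph t r) (t + p - 1).
Proof.
split; [split |].
(* From t >= 6 follows p >= 2, so t + p - 1 is at least 7. *)
- by apply: (@leq_trans 'C(7, 2)) => //; apply: leq_bin2l; lia.
(* At n = t + p - 1 = 3p + q + 1 the quotient by 3 is p because q <= 1, so n - n %/ 3 + 1 = t; this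
   expression does not decrease as n grows. *)
- move=> n le_n c c_exact; apply: rainbow_or_star => //; lia.
move=> M [_ M_bound]; rewrite leqNgt; apply/negP => lt_M.
(* A smaller M would be at most t + p - 2 = 3p + q, the order of the residue coloring. *)
have n6 : 6 <= t + p - 2 by lia.
case: (M_bound (t + p - 2) _ _ (mod3_exact n6)); first by lia.
  exact: mod3_no_rainbow.
by apply: (@mod3_no_star _ p); lia.
Qed.
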